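(* For every fixed integer $k\ge 2$, $\chi_1(KG(n,k))=n-\Theta(n^{1/k})$ as $n\to\infty$; that is, there exist constants $c_1,c_2>0$ and $N$ depending only on $k$ such that $c_1 n^{1/k}\le n-\chi_1(KG(n,k))\le c_2 n^{1/k}$ for all $n\ge N$.
   Context: For integers $k\ge 2$, $n\ge 2k$, the Kneser graph $KG(n,k)$ has vertex set $\binom{[n]}{k}$, two $k$-subsets of $[n]$ being adjacent iff they are disjoint. A 1-selection of a graph $G=(V,E)$ is a map $f$ assigning to each vertex $v$ a set $f(v)$ of at most one edge incident with $v$; the 1-removed subgraph $G_f$ has vertex set $V$ and edge set $E\setminus\bigcup_v f(v)$. The robust chromatic number is $\chi_1(G)=\min_f\chi(G_f)$ over all 1-selections $f$. *)

(* Defs.v *)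
From mathcomp Require Import all_boot.

Set Implicit Arguments.
Unset Strict Implicit.
Unset Printing Implicit Defensive.

Record sgraph := SGraph {
  vertex :> finType;
  adj : rel vertex;
  adj_sym : symmetric adj;
  adj_irr : irreflexive adj
}.

Definition edges (G : sgraph) : {set {set G}} :=
  [set [set p.1; p.2] | p : G * G & adj p.1 p.2].

Definition proper_coloring (G : sgraph) (c : nat) (col : {ffun G -> 'I_c}) :=
  [forall x, forall y, adj x y ==> (col x != col y)].

Definition colorable (G : sgraph) (c : nat) : bool :=
  [exists col : {ffun G -> 'I_c}, proper_coloring col].

Lemma ex_colorable (G : sgraph) : exists c, colorable G c.
Proof.
exists #|G|; apply/existsP; exists [ffun x => enum_rank x].
apply/forallP => x; apply/forallP => y; apply/implyP => xy.
rewrite !ffunE; apply: contraTneq xy => /enum_rank_inj ->.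
by rewrite adj_irr.
Qed.

Definition chromatic_number (G : sgraph) : nat := ex_minn (ex_colorable G).

Definition one_selection (G : sgraph) (f : {ffun G -> {set {set G}}}) : bool :=
  [forall v, (#|f v| <= 1) && (f v \subset [set e in edges G | v \in e])].

Section RemovedSubgraph.
Variables (G : sgraph) (f : {ffun G -> {set {set G}}}).

Definition removed_adj : rel G :=
  fun x y => adj x y && ([set x; y] \notin \bigcup_(v : G) f v).

Lemma removed_adj_sym : symmetric removed_adj.
Proof. by move=> x y; rewrite /removed_adj adj_sym setUC. Qed.

Lemma removed_adj_irr : irreflexive removed_adj.
Proof. by move=> x; rewrite /removed_adj adj_irr. Qed.

Definition removed_subgraph : sgraph := SGraph removed_adj_sym removed_adj_irr.

End RemovedSubgraph.

Definition removed_chromatic (G : sgraph) (m : nat) : bool :=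
  [exists f : {ffun G -> {set {set G}}},
    one_selection f && (chromatic_number (removed_subgraph f) == m)].

Lemma ex_removed_chromatic (G : sgraph) : exists m, removed_chromatic G m.
Proof.
pose f : {ffun G -> {set {set G}}} := [ffun _ => set0].
exists (chromatic_number (removed_subgraph f)).
apply/existsP; exists f; rewrite eqxx andbT.
by apply/forallP => v; rewrite ffunE cards0 sub0set.
Qed.

Definition robust_chromatic_number (G : sgraph) : nat :=
  ex_minn (ex_removed_chromatic G).

Section Kneser.
Variables n k : nat.

Definition ksubset := {A : {set 'I_n} | #|A| == k}.

(* For k > 0 the condition A != B follows from disjointness; it only matters
   for k = 0, where the empty set is disjoint from itself. *)
Definition kneser_adj : rel ksubset :=
  fun A B => (A != B) && [disjoint val A & val B].

Lemma kneser_adj_sym : symmetric kneser_adj.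
Proof. by move=> A B; rewrite /kneser_adj eq_sym disjoint_sym. Qed.

Lemma kneser_adj_irr : irreflexive kneser_adj.
Proof. by move=> A; rewrite /kneser_adj eqxx. Qed.

Definition kneser : sgraph := SGraph kneser_adj_sym kneser_adj_irr.

End Kneser.

(* Main.v *)
(** Removing a 1-selection means that the edges inside each colour class are
    charged to their ends, at most one edge per vertex; equivalently every class
    induces a pseudoforest.

    Upper bound: let M be a set of m points with C(m, k) <= n - m.  Use the
    n - m stars centred outside M and add at most one k-subset of M to each; the
    edges inside a class then form a star around the added set.

    Lower bound: a class with more than C_k |X|^(k-2) members inside X has a
    point x in X such that at most one of its members inside X avoids x, because
    some member meets almost all the others and K_{2,3} is not a pseudoforest.
    Removing such centres greedily leaves |X| = d + t points, where d = n - c and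
    t classes survive, and counting the k-subsets of X gives
    C(d + t, k) <= n + t C_k (d + t)^(k-2).  As 2 d t <= (d + t)^2, for d large
    this forces d^k = O(n). *)

Require Import Defs.
From mathcomp Require Import all_boot all_order all_algebra.
From mathcomp Require Import reals exp zify.

Set Implicit Arguments.
Unset Strict Implicit.
Unset Printing Implicit Defensive.

Import Order.TTheory GRing.Theory Num.Theory.
Local Open Scope ring_scope.
Local Open Scope nat_scope.

(** * 1-selections as partner maps *)

Lemma set2_inj (T : finType) (x y z : T) : [set x; y] = [set x; z] -> y = z.
Proof.
move=> e; have: y \in [set x; z] by rewrite -e set22.
have: z \in [set x; y] by rewrite e set22.
by rewrite !inE => /orP[/eqP->|/eqP->] // /orP[/eqP->|/eqP->].
Qed.

(** The map [p] encodes a 1-selection: [v] selects the edge to [p v] if there is one, and nothing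
    otherwise. Every monochromatic edge is then removed. *)
Lemma robust_chromatic_le (G : sgraph) (c : nat) (col : G -> 'I_c) (p : G -> G) :
  (forall x y, adj x y -> col x = col y -> p x = y \/ p y = x) ->
  robust_chromatic_number G <= c.
Proof.
move=> colP.
pose f : {ffun G -> {set {set G}}} :=
  [ffun v => if adj v (p v) then [set [set v; p v]] else set0].
have selE x y : adj x y -> p x = y -> [set x; y] \in \bigcup_v f v.
  by move=> xy e; apply/bigcupP; exists x; rewrite // ffunE e xy set11.
apply: (@leq_trans (chromatic_number (removed_subgraph f))).
  rewrite /robust_chromatic_number; case: ex_minnP => m _; apply.
  apply/existsP; exists f; rewrite eqxx andbT; apply/forallP => v.
  rewrite ffunE; case: ifP => vp; last by rewrite cards0 sub0set.
  rewrite cards1 sub1set inE set21 andbT.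
  by apply/imsetP; exists (v, p v); rewrite ?inE.
rewrite /chromatic_number; case: ex_minnP => m _; apply.
apply/existsP; exists [ffun x => col x]; apply/forallP => x; apply/forallP => y.
apply/implyP => /andP[xy nf]; rewrite !ffunE; apply: contraNneq nf => e.
have [pxy|pyx] := colP _ _ xy e; first exact: selE.
by rewrite setUC; apply: selE => //; rewrite adj_sym.
Qed.

(** Converse encoding: [p x] is the other end of the edge selected by [x], and [x] itself if none is
    selected. *)
Lemma robust_chromatic_witness (G : sgraph) :
  exists (col : G -> 'I_(robust_chromatic_number G)) (p : G -> G),
    forall x y, adj x y -> col x = col y -> p x = y \/ p y = x.
Proof.
rewrite /robust_chromatic_number.
case: ex_minnP => c /existsP[f /andP[/forallP fP /eqP fc]] _.
move: fc; rewrite /chromatic_number.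
case: ex_minnP => m /existsP[col /forallP colP] _ mc; subst m.
exists col, (fun x => odflt x [pick y | [set x; y] \in f x]).
have sel x y : [set x; y] \in f x ->
    odflt x [pick z | [set x; z] \in f x] = y.
  move=> fxy; case: pickP => [z fxz|/(_ y)]; last by rewrite fxy.
  have /andP[f1 _] := fP x.
  exact/(@set2_inj _ x)/(card_le1_eqP f1).
move=> x y xy cxy; have /forallP/(_ y)/implyP := colP x.
rewrite cxy eqxx => /contraNN -/(_ isT); rewrite /= /removed_adj xy /= negbK.
case/bigcupP => v _ fv; have /andP[_ /subsetP/(_ _ fv)] := fP v.
rewrite !inE => /andP[_ /orP[] /eqP e]; subst v; first by left; apply: sel.
by right; apply: sel; rewrite setUC.
Qed.

(** * Binomial estimates and counting *)

Lemma bin_leq_exp m k : 'C(m, k) <= m ^ k.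
Proof.
apply: (@leq_trans (m ^_ k)).
  by rewrite -bin_ffact leq_pmulr // fact_gt0.
elim: k => // k IH; rewrite ffactnSr expnSr leq_mul //; lia.
Qed.

(** Each of the [k] factors of the falling factorial is at least half of [m]. *)
Lemma exp_leq_bin m k : k.*2 <= m -> m ^ k <= 2 ^ k * k`! * 'C(m, k).
Proof.
move=> km; rewrite -mulnA [k`! * _]mulnC bin_ffact.
have H j : j <= k -> m ^ j <= 2 ^ j * m ^_ j.
  elim: j => [|j IH] jk; first by [].
  rewrite !expnSr ffactnSr -mulnA (mulnCA 2) mulnA leq_mul ?IH 1?ltnW //.
  lia.
exact: H.
Qed.

Lemma card_sum_pred (T : finType) (F : {set T}) (Q : pred T) :
  #|[set A in F | Q A]| = \sum_(A in F) Q A.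
Proof.
by rewrite -sum1dep_card big_mkcondr; apply: eq_bigr => A _; case: (Q A).
Qed.

Lemma card_le_sum (I T : finType) (S : {set I}) (F : {set T}) (Q : I -> pred T) :
  (forall A, A \in F -> exists2 y, y \in S & Q y A) ->
  #|F| <= \sum_(y in S) #|[set A in F | Q y A]|.
Proof.
move=> FQ; apply: (@leq_trans (\sum_(A in F) \sum_(y in S) Q y A)).
  rewrite -sum1_card; apply: leq_sum => A /FQ[y yS QyA].
  by rewrite (bigD1 y) //= QyA.
by rewrite exchange_big; apply: leq_sum => y _; rewrite card_sum_pred.
Qed.

(** * Lower bound: structure of the colour classes *)

Section Classes.
Variables (T : finType) (k c : nat) (col : {set T} -> 'I_c).
Variable p : {set T} -> {set T}.
Hypothesis k2 : 2 <= k.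
Hypothesis colP : forall A B : {set T}, #|A| = k -> #|B| = k ->
  [disjoint A & B] -> col A = col B -> p A = B \/ p B = A.

Definition color_class (X : {set T}) (i : 'I_c) : {set {set T}} :=
  [set A : {set T} | [&& A \subset X, #|A| == k & col A == i]].

Lemma color_classP (X : {set T}) (i : 'I_c) (A : {set T}) :
  reflect [/\ A \subset X, #|A| = k & col A = i] (A \in color_class X i).
Proof.
rewrite inE; apply: (iffP and3P) => -[-> ? ?]; split=> //; exact/eqP.
Qed.

Lemma card_pair_star (X : {set T}) (x y : T) : x != y ->
  #|[set A : {set T} | [&& A \subset X, #|A| == k, x \in A & y \in A]]|
    <= #|X| ^ (k - 2).
Proof.
move=> xy; set P := [set A | _].
apply: leq_trans (bin_leq_exp _ _); rewrite -cards_draws.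
rewrite -(@card_in_imset _ _ (fun A : {set T} => A :\ x :\ y) P); last first.
  move=> A B; rewrite !inE => /and4P[_ _ xA yA] /and4P[_ _ xB yB] e.
  rewrite -(setD1K xA) -(setD1K xB).
  have yA' : y \in A :\ x by rewrite !inE eq_sym xy.
  have yB' : y \in B :\ x by rewrite !inE eq_sym xy.
  by rewrite -(setD1K yA') -(setD1K yB') e.
apply: subset_leq_card; apply/subsetP => B /imsetP[A + ->].
rewrite !inE => /and4P[AX /eqP Ak xA yA]; apply/andP; split.
  exact: subset_trans (subsetDl _ _) (subset_trans (subsetDl _ _) AX).
have yA' : y \in A :\ x by rewrite !inE eq_sym xy.
have := cardsD1 x A; have := cardsD1 y (A :\ x); rewrite xA yA' Ak; lia.
Qed.

(** Union bound over the point [y] of [S] that is hit; [y] differs from [x], so [card_pair_star]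
    applies. *)
Lemma card_star_meeting (X S : {set T}) x : x \notin S -> #|S| = k ->
  #|[set A : {set T} |
      [&& A \subset X, #|A| == k, x \in A & ~~ [disjoint A & S]]]|
    <= k * #|X| ^ (k - 2).
Proof.
move=> xS Sk; rewrite -{2}Sk -sum_nat_const.
pose Q (y : T) (A : {set T}) := y \in A.
apply: leq_trans (@card_le_sum _ _ S _ Q _) _.
  move=> A; rewrite inE => /and4P[_ _ _ /pred0Pn[y /andP[yA yS]]].
  by exists y.
apply: leq_sum => y yS.
have xy : x != y by apply: contraNneq xS => ->.
apply: leq_trans (card_pair_star X xy); apply: subset_leq_card.
apply/subsetP => A; rewrite !inE /Q.
by move=> /andP[/and4P[-> -> -> _] ->].
Qed.

(* Each member selects at most one neighbour, so some member is selected at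
   most once and hence has at most two neighbours. *)
Lemma class_few_disjoint (X : {set T}) (i : 'I_c) : color_class X i != set0 ->
  exists2 A, A \in color_class X i &
    #|[set B in color_class X i | [disjoint A & B]]| <= 2.
Proof.
set F := color_class X i => /set0Pn[A0 A0F].
have [A AF Asel] : exists2 A, A \in F & #|[set B in F | p B == A]| <= 1.
  apply/exists_inP; apply: contraT; rewrite negb_exists_in => /forall_inP H.
  have : \sum_(A in F) #|[set B in F | p B == A]| <= #|F|.
    under eq_bigr do rewrite card_sum_pred.
    rewrite exchange_big /= -sum1_card; apply: leq_sum => B _.
    have [pBF|pBF] := boolP (p B \in F).
      rewrite (bigD1 (p B)) //= eqxx big1 // => A /andP[_].
      by rewrite eq_sym => /negbTE ->.
    by rewrite big1 // => A AF; case: (eqVneq (p B) A) pBF => // ->; rewrite AF.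
  have : \sum_(A in F) 2 <= \sum_(A in F) #|[set B in F | p B == A]|.
    by apply: leq_sum => A /H; rewrite -ltnNge.
  rewrite sum_nat_const; have : 0 < #|F| by apply/card_gt0P; exists A0.
  lia.
exists A => //.
apply: (@leq_trans #|p A |: [set B in F | p B == A]|).
  apply: subset_leq_card; apply/subsetP => B; rewrite inE => /andP[BF dAB].
  have /color_classP[_ Ak Ac] := AF; have /color_classP[_ Bk Bc] := BF.
  have [<-|pB] := colP Ak Bk dAB (etrans Ac (esym Bc)); first exact: setU11.
  by rewrite in_setU1 inE BF pB eqxx orbT.
by rewrite cardsU1 (leq_add (leq_b1 _) Asel).
Qed.

(* Two members of a class have at most two common neighbours, since each of the
   five vertices of a K_{2,3} can account for only one of its six edges. *)
Lemma card_common_disjoint (X : {set T}) (i : 'I_c) (S1 S2 : {set T}) : S1 != S2 ->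
  S1 \in color_class X i -> S2 \in color_class X i ->
  #|[set A in color_class X i | [disjoint A & S1] && [disjoint A & S2]]| <= 2.
Proof.
move=> S12 /color_classP[_ S1k S1c] /color_classP[_ S2k S2c].
apply: (@leq_trans #|[set p S1; p S2]|); last by rewrite cards2; case: (_ != _).
apply: subset_leq_card; apply/subsetP => A; rewrite inE.
move=> /and3P[/color_classP[_ Ak Ac] d1 d2].
have [e1|<-] := colP Ak S1k d1 (etrans Ac (esym S1c)); last exact: set21.
have [e2|<-] := colP Ak S2k d2 (etrans Ac (esym S2c)); last exact: set22.
by rewrite -e1 e2 eqxx in S12.
Qed.

(** This is [k * (2 * k + 2) + 2]: each of the [k] points of a member [A] lies in few members, and
    two more may be disjoint from [A]. *)
Definition class_bound := 2 * k ^ 2 + 2 * k + 2.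

(** By pigeonhole some point [a] of a member with at most two neighbours is popular. If [S1] and
    [S2] were distinct members avoiding [a], every member through [a] would meet [S1], meet [S2] or
    be disjoint from both, which leaves too few of them. *)
Lemma large_class_center (X : {set T}) (i : 'I_c) :
  class_bound * #|X| ^ (k - 2) < #|color_class X i| ->
  exists2 x, x \in X & #|color_class (X :\ x) i| <= 1.
Proof.
set F := color_class X i => Fbig.
have F0 : F != set0 by rewrite -card_gt0; apply: leq_trans Fbig.
have [A AF Adeg] := class_few_disjoint F0.
have /color_classP[AX Ak Ac] := AF.
have X0 : 0 < #|X| ^ (k - 2).
  by rewrite expn_gt0 (leq_trans _ (subset_leq_card AX)) // Ak; lia.
have Fsum : #|F| <= 2 + \sum_(a in A) #|[set B : {set T} in F | a \in B]|.
  rewrite -(cardsID [set B : {set T} | [disjoint A & B]] F) leq_add //.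
    apply: leq_trans Adeg; apply: subset_leq_card.
    by apply/subsetP => B; rewrite !inE.
  apply: leq_trans (@card_le_sum _ _ A _ (fun a (B : {set T}) => a \in B) _) _.
    move=> B; rewrite !inE => /andP[/pred0Pn[a /andP[aA aB]] _].
    by exists a.
  apply: leq_sum => a _; apply: subset_leq_card.
  by apply/subsetP => B; rewrite !inE => /andP[/andP[_ ->] ->].
have [a aA abig] : exists2 a, a \in A &
    2 * k * #|X| ^ (k - 2) + 2 < #|[set B in F | a \in B]|.
  apply/exists_inP; apply: contraT; rewrite negb_exists_in => /forall_inP H.
  suff : \sum_(a in A) (2 * k * #|X| ^ (k - 2) + 2) + 2 < #|F|.
    rewrite ltnNge (leq_trans Fsum) // addnC leq_add2r.
    by apply: leq_sum => a /H; rewrite -leqNgt.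
  apply: leq_trans Fbig; rewrite sum_nat_const Ak /class_bound.
  by rewrite -mulnn; move: (#|X| ^ _) X0 => P P0; nia.
exists a; first exact: (subsetP AX).
apply/card_le1_eqP => S1 S2 /color_classP[S1X S1k S1c] /color_classP[S2X S2k S2c].
apply: contraTeq abig; rewrite eq_sym -leqNgt => S12.
have notin (S : {set T}) : S \subset X :\ a -> a \notin S.
  by move=> SX; apply/negP => /(subsetP SX); rewrite !inE eqxx.
have inF (S : {set T}) : S \subset X :\ a -> #|S| = k -> col S = i -> S \in F.
  move=> SX Sk Sc; apply/color_classP; split=> //.
  exact: subset_trans SX (subsetDl _ _).
have m1 := card_star_meeting X (notin _ S1X) S1k.
have m2 := card_star_meeting X (notin _ S2X) S2k.
have m3 := card_common_disjoint S12 (inF _ S1X S1k S1c) (inF _ S2X S2k S2c).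
move: m1 m2 m3; set M1 := finset _; set M2 := finset _; set M3 := finset _ => m1 m2 m3.
have : #|[set B in F | a \in B]| <= #|M1 :|: M2 :|: M3|.
  apply: subset_leq_card; apply/subsetP => B; rewrite inE => /andP[BF aB].
  have /color_classP[BX Bk Bc] := BF; rewrite !inE BX Bk Bc !eqxx aB /=.
  by case: [disjoint B & S1]; case: [disjoint B & S2].
move/leq_trans; apply; apply: leq_trans (leq_card_setU _ _).1 _.
rewrite leq_add //; apply: leq_trans (leq_card_setU _ _).1 _.
by rewrite -mulnA mul2n -addnn leq_add.
Qed.

(** Greedy removal as an extremal choice: take [D] maximal. A large class outside [D] would supply
    one more centre, and shrinking [X] keeps the classes of [D] small. *)
Lemma center_removal : exists (X : {set T}) (D : {set 'I_c}),
  [/\ #|X| + #|D| = #|T|, forall i, i \in D -> #|color_class X i| <= 1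
    & forall i, i \notin D -> #|color_class X i| <= class_bound * #|X| ^ (k - 2)].
Proof.
pose P (d : {set T} * {set 'I_c}) := (#|d.1| + #|d.2| == #|T|) &&
  [forall i in d.2, #|color_class d.1 i| <= 1].
have P0 : P (setT, set0).
  by rewrite /P cardsT cards0 addn0 eqxx; apply/forall_inP => i; rewrite inE.
case: (arg_maxnP (fun d : {set T} * {set 'I_c} => #|d.2|) P0) => -[X D].
move=> /andP[/eqP /= XD /forall_inP /= DP] Dmax.
exists X, D; split=> // i iD; rewrite leqNgt; apply/negP => /large_class_center.
case=> x xX x1; have /Dmax : P (X :\ x, i |: D); last first.
  by rewrite /= cardsU1 iD add1n ltnn.
apply/andP; split; first by rewrite /= cardsU1 iD -XD (cardsD1 x X) xX addnCA addnA.
apply/forall_inP => j; rewrite !inE => /orP[/eqP->//|/DP].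
apply: leq_trans; apply: subset_leq_card; apply/subsetP => A.
move=> /color_classP[AX Ak Ac]; apply/color_classP; split=> //.
exact: subset_trans AX (subsetDl _ _).
Qed.

(** The constant adds up two cases: the power in parentheses serves small [d], the first summand
    large [d]. *)
Lemma deficit_exp_le : c < #|T| ->
  (#|T| - c) ^ k <=
    (2 ^ k.+1 * k`! + (2 ^ k * k`! * class_bound + k.*2) ^ k) * #|T|.
Proof.
move=> cT; set Q := 2 ^ k * k`!; set C := class_bound; set n := #|T|.
have [X [D [XD D1 D2]]] := center_removal.
have Dc : #|D| <= c by rewrite -[c in _ <= c]card_ord max_card.
pose t := c - #|D|; pose d := n - c.
have Xdt : #|X| = d + t by rewrite /d /t /n; lia.
have count : 'C(#|X|, k) <= n + t * (C * #|X| ^ (k - 2)).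
  rewrite -cards_draws.
  apply: leq_trans (@card_le_sum _ _ [set: 'I_c] _
    (fun i (A : {set T}) => col A == i) _) _.
    by move=> A _; exists (col A); rewrite ?inE.
  rewrite (bigID (mem D)) /=; apply: leq_add.
    apply: (@leq_trans (\sum_(i in D) 1)); last by rewrite sum1_card /n; lia.
    under eq_bigl do rewrite inE.
    apply: leq_sum => i /D1; apply: leq_trans; apply: subset_leq_card.
    by apply/subsetP => A; rewrite !inE andbA.
  apply: (@leq_trans (\sum_(i in ~: D) C * #|X| ^ (k - 2))); last first.
    by rewrite sum_nat_const cardsCs setCK card_ord.
  under eq_bigl do rewrite in_setT.
  under [leqRHS]eq_bigl do rewrite in_setC.
  apply: leq_sum => i /D2; apply: leq_trans; apply: subset_leq_card.
  by apply/subsetP => A; rewrite !inE andbA.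
(* The summand [k.*2] allows [exp_leq_bin]; [Q * C] makes [Q * C * t] at most [d * t]. *)
have [dbig|dsmall] := leqP (Q * C + k.*2) d; last first.
  have n0 : 0 < n by lia.
  rewrite -/d -[leqLHS]muln1 leq_mul // (leq_trans _ (leq_addl _ _)) //.
  by rewrite leq_exp2r ltnW // ltnW.
have Xk := @exp_leq_bin #|X| k; rewrite -/Q Xdt in Xk.
have {Xk} := Xk (ltac:(lia)); rewrite -Xdt => Xk.
have Xsplit : #|X| ^ k = #|X| ^ 2 * #|X| ^ (k - 2) by rewrite -expnD subnKC.
(* Hence the surviving classes account for at most half of [#|X| ^ k], which the left side
   absorbs. *)
have sq : 2 * (Q * C * t) <= #|X| ^ 2.
  apply: (@leq_trans (2 * (d * t))).
    by rewrite leq_mul2l leq_mul2r (leq_trans _ dbig) ?leq_addr ?orbT.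
  by rewrite Xdt sqrnD leq_addl.
have sqk : 2 * (Q * C * t * #|X| ^ (k - 2)) <= #|X| ^ k.
  by rewrite mulnA Xsplit leq_mul2r sq orbT.
have Xn : #|X| ^ k <= 2 * Q * n.
  have : Q * 'C(#|X|, k) <= Q * (n + t * (C * #|X| ^ (k - 2))).
    by rewrite leq_mul2l count orbT.
  rewrite mulnDr => /(leq_trans Xk) {}Xk; move: Xk sqk.
  rewrite (_ : Q * (t * (C * _)) = Q * C * t * #|X| ^ (k - 2)); last first.
    by rewrite -!mulnA [t * (C * _)]mulnCA.
  rewrite -[2 * Q * n]mulnA.
  move: (#|X| ^ k) (Q * C * t * _) (Q * n) => a b e; lia.
apply: (@leq_trans (#|X| ^ k)); first by rewrite Xdt leq_exp2r ?leq_addr //; lia.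
apply: (leq_trans Xn).
by rewrite leq_mul2r expnS -[2 * _ * k`!]mulnA leq_addr orbT.
Qed.

End Classes.

Lemma robust_kneser_deficit n k : 2 <= k -> k <= n ->
  robust_chromatic_number (kneser n k) < n ->
  (n - robust_chromatic_number (kneser n k)) ^ k <=
    (2 ^ k.+1 * k`! + (2 ^ k * k`! * class_bound k + k.*2) ^ k) * n.
Proof.
move=> k2 kn; have [col [p colP]] := robust_chromatic_witness (kneser n k).
move: (robust_chromatic_number _) col colP => c col colP cn.
have [A0 A0k] : exists A : {set 'I_n}, #|A| == k.
  have : 0 < #|[set A : {set 'I_n} | #|A| == k]|.
    by rewrite card_draws card_ord bin_gt0.
  by case/card_gt0P => A; rewrite inE; exists A.
(* The default [A0] is a dummy: only the values of [v] on [k]-subsets matter. *)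
pose v (A : {set 'I_n}) : kneser n k := insubd (Sub A0 A0k : ksubset n k) A.
have vK (A : {set 'I_n}) : #|A| = k -> val (v A) = A by move/eqP => Ak; rewrite val_insubd Ak.
have := @deficit_exp_le 'I_n k c (fun A => col (v A)) (fun A => val (p (v A))).
rewrite card_ord; apply=> // A B Ak Bk dAB cAB.
have AB : v A != v B.
  apply: contraTneq dAB => /(congr1 val); rewrite !vK // => ->.
  by rewrite -setI_eq0 setIid -card_gt0 Bk; lia.
have adjAB : @adj (kneser n k) (v A) (v B).
  apply/andP; split=> //; move: (vK A Ak) (vK B Bk) dAB.
  by rewrite /= => -> ->.
by have [->|->] := colP _ _ adjAB cAB; [left|right]; apply: vK.
Qed.

(** * Upper bound: stars enlarged by one set each *)

Lemma robust_kneser_le n k m : m < n -> 'C(m, k) <= n - m ->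
  robust_chromatic_number (kneser n k) <= n - m.
Proof.
move=> mn Cm; have nm : 0 < n - m by rewrite subn_gt0.
pose M := [set i : 'I_n | n - m <= i].
(* The position in [E] gives the subsets of [M] pairwise distinct colours below [n - m]. *)
pose E := enum [set A : {set 'I_n} | (A \subset M) && (#|A| == k)].
have Mm : #|M| = m.
  have -> : M = ~: [set widen_ord (leq_subr m n) i | i : 'I_(n - m)].
    apply/setP => i; rewrite !inE; apply/idP/idP => [ni|].
      by apply/imsetP => -[j _ ij]; move: ni; rewrite ij /= leqNgt ltn_ord.
    apply: contraR; rewrite -ltnNge => ni; apply/imsetP.
    by exists (Ordinal ni) => //; apply: val_inj.
  rewrite cardsCs setCK card_imset ?card_ord ?subKn 1?ltnW //.
  by move=> i j /(congr1 val) /= /val_inj.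
have index_lt (A : ksubset n k) : val A \subset M -> index (val A) E < n - m.
  move=> AM; apply: leq_trans Cm; rewrite -[m in leqRHS]Mm -cards_draws cardE index_mem.
  by rewrite mem_enum inE AM (valP A).
have col_lt (A : ksubset n k) :
    (if [pick i in val A | i < n - m] is Some i then i : nat
     else index (val A) E) < n - m.
  case: pickP => [i /andP[]//|H]; apply: index_lt; apply/subsetP => i iA.
  by rewrite inE leqNgt; have := H i; rewrite iA /= => ->.
pose col (A : kneser n k) : 'I_(n - m) := Ordinal (col_lt A).
have colM (A : kneser n k) : val A \subset M -> col A = index (val A) E :> nat.
  move=> AM; rewrite /col /=; case: pickP => // i /andP[iA].
  by have := subsetP AM _ iA; rewrite inE leqNgt => /negbTE ->.
have colN (A : kneser n k) : ~~ (val A \subset M) ->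
    exists2 i, i \in val A & col A = i :> nat.
  case/subsetPn => i iA; rewrite inE -ltnNge => ni; rewrite /col /=.
  by case: pickP => [j /andP[jA _]|/(_ i)]; [exists j | rewrite iA ni].
have col_inj (A B : kneser n k) : val A \subset M -> val B \subset M ->
    col A = col B -> A = B.
  move=> AM BM /(congr1 (@nat_of_ord _)); rewrite colM // colM // => e.
  apply: val_inj; apply: (@index_inj _ set0 E _ _ _ _ e); rewrite mem_enum inE.
    by rewrite AM (valP A).
  by rewrite BM (valP B).
(* Each set selects the edge to the only subset of [M] of its colour, if there is one. *)
pose p (A : kneser n k) : kneser n k :=
  odflt A [pick B : kneser n k | (val B \subset M) && (col B == col A)].
have pE (A B : kneser n k) : val B \subset M -> col A = col B -> p A = B.
  move=> BM cAB; rewrite /p; case: pickP => [B' /andP[B'M /eqP e]|/(_ B)] /=.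
    by apply: col_inj; rewrite // e.
  by rewrite BM cAB eqxx.
apply: (@robust_chromatic_le _ _ col p) => A B /andP[_ dAB] cAB.
have [AM|AM] := boolP (val A \subset M); first by right; apply: pE.
have [BM|BM] := boolP (val B \subset M); first by left; apply: pE.
have [i iA ci] := colN A AM; have [j jB cj] := colN B BM.
have ij : i = j by apply: ord_inj; rewrite -ci -cj cAB.
by move: jB; rewrite -ij (disjointFr dAB iA).
Qed.

(** Take the largest [m] with [2 * m ^ k <= n]. As [m <= m ^ k], this leaves [m ^ k <= n - m],
    enough colours for [robust_kneser_le]. *)
Lemma robust_kneser_root n k : 0 < k -> 1 < n -> exists m,
  robust_chromatic_number (kneser n k) + m <= n /\ n <= (2 ^ k.+1 * m) ^ k.
Proof.
move=> k0 n2; have ex : exists m, 2 * m ^ k <= n by exists 0; rewrite exp0n.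
have bnd m : 2 * m ^ k <= n -> m <= n.
  move=> h; apply: leq_trans (_ : m ^ k <= _); last by lia.
  by case: m {h} => // m; rewrite -{1}[m.+1]expn1 leq_pexp2l.
case: (ex_maxnP ex bnd) => m mn mmax; exists m.
have m1 : 0 < m by apply: mmax; rewrite exp1n.
have mk : m <= m ^ k by rewrite -{1}[m]expn1 leq_pexp2l.
split.
  suff : robust_chromatic_number (kneser n k) <= n - m by lia.
  apply: robust_kneser_le; first by lia.
  by apply: leq_trans (bin_leq_exp _ _) _; lia.
(* Maximality bounds [n] from above; [m.+1 <= 2 * m] since [m] is positive. *)
have : n < 2 * m.+1 ^ k by rewrite ltnNge; apply/negP => /mmax; rewrite ltnn.
move/ltnW/leq_trans; apply; apply: (@leq_trans (2 * (2 * m) ^ k)).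
  by rewrite leq_mul2l /= leq_exp2r //; lia.
rewrite !expnMn mulnA -expnS leq_mul2r -expnM; apply/orP; right.
by rewrite leq_exp2l // leq_pmulr.
Qed.

(* Passage to real [k]-th roots *)
Local Close Scope nat_scope.

Theorem theorem1p7 (R : realType) (k : nat) (hk : (2 <= k)%N) :
  exists (c1 c2 : R) (N : nat),
    [/\ 0 < c1, 0 < c2 &
      forall n : nat, (N <= n)%N ->
        c1 * (n%:R `^ k%:R^-1)
          <= n%:R - (robust_chromatic_number (kneser n k))%:R
          <= c2 * (n%:R `^ k%:R^-1)].
Proof.
have k0 : (0 < k)%N by apply: ltnW.
pose K := (2 ^ k.+1 * k`! + (2 ^ k * k`! * class_bound k + k.*2) ^ k)%N.
have K0 : (0 < K)%N by rewrite addn_gt0 muln_gt0 expn_gt0 fact_gt0.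
have rootK (x : R) : 0 <= x -> (x `^ k%:R^-1) ^+ k = x.
  by move=> x0; rewrite -powR_mulrn ?powR_ge0 // -powRrM mulVf ?powRr1 // pnatr_eq0 -lt0n.
exists ((2 ^ k.+1)%:R^-1), K%:R, k; split; first by rewrite invr_gt0 ltr0n expn_gt0.
  by rewrite ltr0n.
move=> n kn; apply/andP; split.
  have [m [rm nm]] := robust_kneser_root k0 (leq_trans hk kn).
  apply: (@le_trans _ _ m%:R); last by rewrite lerBrDl -natrD ler_nat.
  rewrite ler_pdivrMl ?ltr0n ?expn_gt0 // -natrM.
  by rewrite -(ler_pXn2r k0) ?nnegrE ?powR_ge0 // rootK // -natrX ler_nat.
(* The real difference may only be replaced by the truncated one when it is nonnegative; otherwise
   the bound is trivial. *)
have [rn|rn] := ltnP (robust_chromatic_number (kneser n k)) n; last first.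
  apply: (@le_trans _ _ 0); first by rewrite subr_le0 ler_nat.
  by rewrite mulr_ge0 ?powR_ge0.
rewrite -natrB 1?ltnW // -(ler_pXn2r k0) ?nnegrE ?mulr_ge0 ?powR_ge0 //.
rewrite exprMn rootK // -!natrX -natrM ler_nat.
apply: leq_trans (robust_kneser_deficit hk kn rn) _.
(* Taking [K] instead of its [k]-th root as constant costs only [K <= K ^ k]. *)
by rewrite -/K leq_mul2r -{1}[K]expn1 leq_pexp2l ?orbT.
Qed.
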